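(* Assume that $T$ is a unilateral shift (of any multiplicity), that $\|X\|<1$, and that $\dim\ker\bar\omega\le\dim\ker\bar\omega^*$. Let $R_0\in\mathcal L(\ker\bar\omega,\ker\bar\omega^* )$ be any isometry. Define the free Schur contraction by $R(z)=R_0$ $(z\in\mathbb D)$ and let $Y$ be the corresponding contractive intertwining lifting of $X$. Then $Y$ is an isometry.
   Context: All Hilbert spaces are complex and separable; $\mathbb D$ is the open unit disc. For a contraction $C$, $D_C=(I-C^*C)^{1/2}$ and $\mathcal D_C$ is the closure of the range of $D_C$. $H^2(\mathcal E)$ is the Hardy space of $\mathcal E$-valued functions on $\mathbb D$. Setting: $T'\in\mathcal L(\mathcal H')$ is a completely nonunitary contraction, $T\in\mathcal L(\mathcal H)$ is an isometry, $X\in\mathcal L(\mathcal H,\mathcal H')$ satisfies $T'X=XT$, $\|X\|\le1$. The minimal isometric lifting of $T'$ is $U'$ on $\mathcal K'=\mathcal H'\oplus H^2(\mathcal D_{T'})$, $U'(h'\oplus f)=T'h'\oplus(D_{T'}h'+zf(z))$; $P'$ is the orthogonal projection of $\mathcal K'$ onto $\mathcal H'$. A contractive intertwining lifting of $X$ is $Y\in\mathcal L(\mathcal H,\mathcal K')$ with $U'Y=YT$, $P'Y=X$, $\|Y\|\le1$. The isometry $\omega:(D_XT\mathcal H)^-\to\{D_{T'}Xh\oplus D_Xh:h\in\mathcal H\}^-\subset\mathcal D_{T'}\oplus\mathcal D_X$ is the continuous extension of $D_XTh\mapsto D_{T'}Xh\oplus D_Xh$. The partial isometry $\bar\omega\in\mathcal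 L(\mathcal D_X,\mathcal D_{T'}\oplus\mathcal D_X)$ equals $\omega$ on $(D_XT\mathcal H)^-$ and $0$ on $\mathcal D_X\ominus(D_XT\mathcal H)^-$. The operators $\Pi',\Pi$ on $\mathcal D_{T'}\oplus\mathcal D_X$ are $\Pi'(d'\oplus d)=d'\in\mathcal D_{T'}$, $\Pi(d'\oplus d)=d\in\mathcal D_X$. A free Schur contraction is an analytic function $R(z)\in\mathcal L(\ker\bar\omega,\ker\bar\omega^* )$ with $\|R(z)\|\le1$ $(z\in\mathbb D)$. With $W(z)=\bar\omega+R(z)(I-\bar\omega^*\bar\omega)$ and $\Gamma(z)=\Pi'W(z)(I-z\Pi W(z))^{-1}$, the corresponding contractive intertwining lifting is $Yh=Xh\oplus\Gamma(\cdot)D_Xh$ $(h\in\mathcal H)$. *)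

(* Defs.v *)
From HB Require Import structures.
From mathcomp Require Import all_boot all_order all_algebra.
From mathcomp Require Import all_classical all_reals all_analysis.
From mathcomp Require Import complex ring.

Set Implicit Arguments.
Unset Strict Implicit.
Unset Printing Implicit Defensive.
Import Order.TTheory GRing.Theory Num.Theory.
Import numFieldNormedType.Exports.
Local Open Scope classical_set_scope.
Local Open Scope ring_scope.
Local Open Scope complex_scope.

HB.mixin Record isInner (R : realType) V & NormedModule R[i] V := {
  inner : V -> V -> R[i] ;
  innerPl : forall (a : R[i]) (x y z : V),
    inner (a *: x + y) z = a * inner x z + inner y z ;
  inner_conj : forall x y : V, inner y x = Num.conj (inner x y) ;
  inner_norm : forall x : V, inner x x = `|x| ^+ 2
}.

#[short(type="innerType")]
HB.structure Definition InnerSpace (R : realType) :=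
  {V of NormedModule R[i] V & isInner R V}.

#[short(type="hilbertType")]
HB.structure Definition Hilbert (R : realType) :=
  {V of CompleteNormedModule R[i] V & isInner R V}.

HB.factory Record Lmodule_isInner (R : realType) V & GRing.Lmodule R[i] V := {
  inner : V -> V -> R[i] ;
  innerPl : forall (a : R[i]) (x y z : V),
    inner (a *: x + y) z = a * inner x z + inner y z ;
  inner_conj : forall x y : V, inner y x = Num.conj (inner x y) ;
  inner_ge0 : forall x : V, 0 <= inner x x ;
  inner_eq0 : forall x : V, inner x x = 0 -> x = 0
}.

HB.builders Context R V & Lmodule_isInner R V.

Let innerDl x y z : inner (x + y) z = inner x z + inner y z.
Proof. by rewrite -[x in inner (x + y)]scale1r innerPl mul1r. Qed.
Let inner0l z : inner 0 z = 0.
Proof. by apply: (addIr (inner 0 z)); rewrite -innerDl !add0r. Qed.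
Let innerZl a x z : inner (a *: x) z = a * inner x z.
Proof. by rewrite -[a *: x]addr0 innerPl inner0l addr0. Qed.
Let innerDr x y z : inner z (x + y) = inner z x + inner z y.
Proof. by rewrite inner_conj innerDl rmorphD/= -!inner_conj. Qed.
Let innerZr a x z : inner z (a *: x) = Num.conj a * inner z x.
Proof. by rewrite inner_conj innerZl rmorphM/= -inner_conj. Qed.

Definition hnorm (x : V) : R[i] := sqrtC (inner x x).

Let hnorm_ge0 x : 0 <= hnorm x.
Proof. by rewrite sqrtC_ge0 inner_ge0. Qed.

Let hnorm_sqr x : hnorm x ^+ 2 = inner x x.
Proof. exact: sqrtCK. Qed.

Let hnormZ l x : hnorm (l *: x) = `|l| * hnorm x.
Proof.
apply: (pexpIrn (n := 2)) => //; rewrite ?nnegrE ?hnorm_ge0 ?mulr_ge0//.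
by rewrite hnorm_sqr exprMn hnorm_sqr innerZl innerZr mulrA normCK.
Qed.

Let cauchy_schwarz x y : `|inner x y| <= hnorm x * hnorm y.
Proof.
have [->|y0] := eqVneq y 0.
  by rewrite inner_conj inner0l rmorph0 normr0 mulr_ge0.
have yy0 : 0 < inner y y.
  by rewrite lt_def inner_ge0 andbT; apply/eqP => /inner_eq0 /eqP; apply/negP.
rewrite -ler_sqr ?nnegrE ?mulr_ge0// exprMn !hnorm_sqr.
have := inner_ge0 (inner y y *: x + (- inner x y) *: y).
rewrite !(innerDl, innerDr, innerZl, innerZr).
have cyy : Num.conj (inner y y) = inner y y by rewrite -inner_conj.
rewrite rmorphN/= cyy -(inner_conj x y) normCK -(inner_conj x y).
set p := inner x y; set q := inner y x; set u := inner x x; set v := inner y y.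
rewrite (_ : _ + _ = v * (u * v - p * q)); last by ring.
by rewrite pmulr_rge0// subr_ge0.
Qed.

Let cross x y : inner x y + inner y x <= hnorm x * hnorm y *+ 2.
Proof.
rewrite [inner y x]inner_conj.
have -> : inner x y + Num.conj (inner x y) = 'Re (inner x y) *+ 2.
  by rewrite ReE -[X in _ = X]mulr_natr divfK ?pnatr_eq0.
rewrite ler_pMn2r//; apply: le_trans (cauchy_schwarz x y).
by rewrite leif_Re_Creal.
Qed.

Let hnormD x y : hnorm (x + y) <= hnorm x + hnorm y.
Proof.
rewrite -ler_sqr ?nnegrE ?addr_ge0// sqrrD !hnorm_sqr innerDl !innerDr.
rewrite [leLHS](_ : _ = inner x x + (inner x y + inner y x) + inner y y).
  by rewrite lerD2r lerD2l; exact: cross.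
by rewrite !addrA.
Qed.

Let hnorm_eq0 x : hnorm x = 0 -> x = 0.
Proof. by move=> /eqP; rewrite sqrtC_eq0 => /eqP /inner_eq0. Qed.

HB.instance Definition _ :=
  Lmodule_isNormed.Build R[i] V hnormD hnormZ hnorm_eq0.

Let inner_hnorm x : inner x x = `|x| ^+ 2.
Proof. by rewrite -hnorm_sqr. Qed.

HB.instance Definition _ := isInner.Build R V innerPl inner_conj inner_hnorm.

HB.end.

Section InnerTheory.
Variables (R : realType) (V : innerType R).
Implicit Types x y z : V.

Lemma innerDl x y z : inner (x + y) z = inner x z + inner y z.
Proof. by rewrite -[x in inner (x + y)]scale1r innerPl mul1r. Qed.

Lemma inner0l z : inner (0 : V) z = 0.
Proof. by apply: (addIr (inner (0 : V) z)); rewrite -innerDl !add0r. Qed.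

Lemma innerZl a x z : inner (a *: x) z = a * inner x z.
Proof. by rewrite -[a *: x]addr0 innerPl inner0l addr0. Qed.

Lemma inner_ge0 x : 0 <= inner x x.
Proof. by rewrite inner_norm exprn_ge0. Qed.

Lemma inner_eq0 x : inner x x = 0 -> x = 0.
Proof. by rewrite inner_norm => /eqP; rewrite expf_eq0/= normr_eq0 => /eqP. Qed.

End InnerTheory.

Record lin_subspace (R : realType) (V : innerType R) := LinSubspace {
  lin_subspace_set :> set V ;
  lin_subspace_submod : submod_closed [pred x | x \in lin_subspace_set] }.

(* As a collective predicate, so that the algebraic structures on subtypes
   apply. *)
Definition in_lin_subspace (R : realType) (V : innerType R)
  (M : lin_subspace V) : {pred V} := fun x => x \in (M : set V).
Arguments in_lin_subspace : simpl never.

HB.instance Definition _ (R : realType) (V : innerType R)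
  (M : lin_subspace V) :=
  GRing.isSubmodClosed.Build R[i] V (in_lin_subspace M) (lin_subspace_submod M).

Record carrier (R : realType) (V : innerType R) (M : lin_subspace V) :=
  SubspaceElt {
    subspace_val : V ;
    subspace_valP : in_lin_subspace M subspace_val }.

Section SubspaceInner.
Variables (R : realType) (V : innerType R) (M : lin_subspace V).
Local Notation S := (carrier M).

HB.instance Definition _ := [isSub for @subspace_val R V M].
HB.instance Definition _ := [Choice of S by <:].
HB.instance Definition _ :=
  GRing.SubChoice_isSubLmodule.Build R[i] V (in_lin_subspace M) S
    (GRing.subsemimodClosedP (in_lin_subspace M)).

Let sinner (x y : S) : R[i] := inner (val x) (val y).

Let sinnerPl a (x y z : S) :
  sinner (a *: x + y) z = a * sinner x z + sinner y z.
Proof. exact: innerPl. Qed.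

Let sinner_conj (x y : S) : sinner y x = Num.conj (sinner x y).
Proof. exact: inner_conj. Qed.

Let sinner_ge0 (x : S) : 0 <= sinner x x.
Proof. exact: inner_ge0. Qed.

Let sinner_eq0 (x : S) : sinner x x = 0 -> x = 0.
Proof. by move=> /inner_eq0 x0; apply: val_inj; rewrite x0. Qed.

HB.instance Definition _ :=
  Lmodule_isInner.Build R S sinnerPl sinner_conj sinner_ge0 sinner_eq0.

End SubspaceInner.

(* The alias keeps the l2-norm apart from the sup norm that MathComp-Analysis
   puts on pairs. *)
Definition hsum (R : realType) (U V : innerType R) : Type := (U * V)%type.

Section HsumInner.
Variables (R : realType) (U V : innerType R).

HB.instance Definition _ := GRing.Lmodule.copy (hsum U V) (U * V)%type.

Let dinner (x y : hsum U V) : R[i] := inner x.1 y.1 + inner x.2 y.2.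

Let dinnerPl a (x y z : hsum U V) :
  dinner (a *: x + y) z = a * dinner x z + dinner y z.
Proof. by rewrite /dinner !innerPl mulrDr addrACA. Qed.

Let dinner_conj (x y : hsum U V) : dinner y x = Num.conj (dinner x y).
Proof. by rewrite /dinner rmorphD/= -!inner_conj. Qed.

Let dinner_ge0 (x : hsum U V) : 0 <= dinner x x.
Proof. by rewrite addr_ge0 ?inner_ge0. Qed.

Let dinner_eq0 (x : hsum U V) : dinner x x = 0 -> x = 0.
Proof.
case: x => u v /eqP; rewrite /dinner/= paddr_eq0 ?inner_ge0//.
by move=> /andP[/eqP /inner_eq0 -> /eqP /inner_eq0 ->].
Qed.

HB.instance Definition _ :=
  Lmodule_isInner.Build R (hsum U V) dinnerPl dinner_conj dinner_ge0 dinner_eq0.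

End HsumInner.

Section Subspaces.
Variables (R : realType) (U V : innerType R).

Lemma closure_submod (A : set V) : submod_closed [pred x | x \in A] ->
  submod_closed [pred x | x \in closure A].
Proof.
move=> [A0 AD]; split=> [|a x y]; rewrite !inE/=.
  by apply: subset_closure; have := A0; rewrite inE.
move=> Ax Ay B xyB.
have : (a *: z.1 + z.2) @[z --> (x, y)] --> a *: x + y.
  by apply: cvgD; [apply: cvgZr; exact: cvg_fst|exact: cvg_snd].
move=> /(_ _ xyB) [[P Q]/= [xP yQ] PQB].
have [u [Au Pu]] := Ax _ xP; have [v [Av Qv]] := Ay _ yQ.
exists (a *: u + v); split; last exact: (PQB (u, v)).
by have := AD a u v; rewrite !inE; apply.
Qed.

Lemma range_submod (D : {linear U -> V}) :
  submod_closed [pred x | x \in range D].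
Proof.
split=> [|a _ _ /[!inE] -[x _ <-] [y _ <-]].
  by rewrite !inE; exists 0 => //; rewrite linear0.
by exists (a *: x + y) => //; rewrite linearP.
Qed.

Lemma kernel_submod (A : {linear U -> V}) :
  submod_closed [pred x | x \in [set x | A x = 0]].
Proof.
split=> [|a x y /[!inE]/= Ax Ay]; first by rewrite !inE/= linear0.
by rewrite linearP Ax Ay scaler0 addr0.
Qed.

Definition ker_op (A : {linear U -> V}) : lin_subspace U :=
  LinSubspace (kernel_submod A).

Definition range_closure (D : {linear U -> V}) : lin_subspace V :=
  LinSubspace (closure_submod (range_submod D)).

Lemma range_closureP (D : {linear U -> V}) h :
  in_lin_subspace (range_closure D) (D h).
Proof. by rewrite /in_lin_subspace inE; apply: subset_closure; exists h. Qed.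

Definition to_range_closure (D : {linear U -> V}) (h : U) :
  carrier (range_closure D) := SubspaceElt (range_closureP D h).

End Subspaces.

Section Operators.
Variable R : realType.
Implicit Types U V : innerType R.

(* The norm of an innerType over R[i] is a nonnegative element of R[i]. *)
Definition rnorm V (x : V) : R := complex.Re `|x|.

Definition opnorm U V (A : U -> V) : \bar R :=
  ereal_sup [set (rnorm (A x))%:E | x in [set x | `|x| <= 1]].

Definition contractive U V (A : U -> V) := (opnorm A <= 1)%E.

Definition is_isometry U V (A : U -> V) := forall x, `|A x| = `|x|.

Definition adjoint_of U V (A : U -> V) (B : V -> U) :=
  forall x y, inner (A x) y = inner x (B y).

(* D = (I - C^* C)^{1/2}.  On a complex space, positivity of the form
   <Dx, x> includes self-adjointness. *)
Definition is_defect U V (C : {linear U -> V}) (D : {linear U -> U}) :=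
  [/\ continuous D, (forall x, 0 <= inner (D x) x) &
      exists2 Cs : {linear V -> U}, adjoint_of C Cs &
        forall x, D (D x) = x - Cs (C x)].

Definition orthocomp V (A : set V) : set V :=
  [set x | forall y, A y -> inner x y = 0].

Definition lin_span V (A : set V) : set V :=
  [set x | exists n (c : 'I_n -> R[i]) (e : 'I_n -> V),
    (forall i, A (e i)) /\ x = \sum_(i < n) c i *: e i].

Definition orthonormal_basis V (S : set V) :=
  [/\ forall x, S x -> `|x| = 1,
      forall x y, S x -> S y -> x <> y -> inner x y = 0 &
      closure (lin_span S) = setT].

Definition hilbert_dim_le U V :=
  exists (S : set U) (S' : set V),
    [/\ orthonormal_basis S, orthonormal_basis S' & (S #<= S')%card].

Definition separable_space V := exists2 A : set V, countable A & dense A.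

(* H is the orthogonal sum of the T^n E; the multiplicity is dim E. *)
Definition unilateral_shift V (T : {linear V -> V}) :=
  is_isometry T /\
  exists E : lin_subspace V,
    [/\ closed E,
        forall m n x y, m <> n -> (E : set V) x -> (E : set V) y ->
          inner (iter m T x) (iter n T y) = 0 &
        closure (lin_span (\bigcup_n (iter n T @` E))) = setT].

Definition is_reducing V (T : V -> V) (M : set V) :=
  T @` M `<=` M /\ T @` orthocomp M `<=` orthocomp M.

Definition completely_nonunitary V (T : V -> V) :=
  forall M : lin_subspace V, closed M -> is_reducing T M ->
    (forall x, (M : set V) x -> `|T x| = `|x|) -> T @` M = (M : set V) ->
    (M : set V) = [set 0].

Definition op_inverse V (A : V -> V) (y : V) : V := xget 0 [set x | A x = y].

End Operators.

Section Hardy.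
Variable R : realType.

Definition unit_disc : Type := {z : R[i] | `|z| < 1}.

Definition power_series_of (E : innerType R) (f : unit_disc -> E)
  (a : nat -> E) :=
  forall z : unit_disc, series (fun n => val z ^+ n *: a n) @ \oo --> f z.

Definition taylor_coef (E : innerType R) (f : unit_disc -> E) : nat -> E :=
  xget (fun=> 0) [set a | power_series_of f a].

Definition hardy_sqnorm (E : innerType R) (f : unit_disc -> E) : \bar R :=
  (\sum_(0 <= n <oo) (rnorm (taylor_coef f n) ^+ 2)%:E)%E.

Definition in_hardy (E : innerType R) (f : unit_disc -> E) :=
  (exists a, power_series_of f a) /\ (hardy_sqnorm f < +oo)%E.

End Hardy.

Section Lifting.
Variables (R : realType) (H' H : hilbertType R).
Variables (T' DT' : {linear H' -> H'}) (T DX : {linear H -> H}).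
Variable X : {linear H -> H'}.

Local Notation dT' := (carrier (range_closure DT')).
Local Notation dX := (carrier (range_closure DX)).

(* The space K' = H' (+) H^2(D_T') is the linear subspace [in_K] of the
   following type, with norm [Knorm]. *)
Local Notation Kfun := (H' * (unit_disc R -> dT'))%type.

Definition in_K (k : Kfun) := in_hardy k.2.

Definition Knorm (k : Kfun) : R :=
  Num.sqrt (rnorm k.1 ^+ 2 + fine (hardy_sqnorm k.2)).

Definition isometric_lifting (k : Kfun) : Kfun :=
  (T' k.1, fun z => to_range_closure DT' k.1 + val z *: k.2 z).

Definition contractive_intertwining_lifting (Y : H -> Kfun) :=
  [/\ linear Y,
      forall h, in_K (Y h),
      forall h, isometric_lifting (Y h) = Y (T h),
      forall h, (Y h).1 = X h &
      forall h, Knorm (Y h) <= rnorm h].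

Definition K_isometry (Y : H -> Kfun) :=
  [/\ linear Y, forall h, in_K (Y h) & forall h, Knorm (Y h) = rnorm h].

(* Continuity and linearity make [wbar] agree on (D_X T H)^- with the
   continuous extension omega of D_X T h |-> D_T' X h (+) D_X h. *)
Definition is_omega_bar (wbar : {linear dX -> hsum dT' dX}) :=
  let M := closure (range (fun h => to_range_closure DX (T h))) in
  [/\ continuous wbar,
      forall h, wbar (to_range_closure DX (T h)) =
        (to_range_closure DT' (X h), to_range_closure DX h) &
      forall d, orthocomp M d -> wbar d = 0].

Variables (wbar : {linear dX -> hsum dT' dX}).
Variables (wbarS : {linear hsum dT' dX -> dX}).
Variable Rf :
  unit_disc R -> {linear carrier (ker_op wbar) -> carrier (ker_op wbarS)}.

(* I - wbar^* wbar is the orthogonal projection of D_X onto ker wbar when wbar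
   is a partial isometry, so that [insubd] never takes its default value 0. *)
Definition Wfun (z : unit_disc R) (d : dX) : hsum dT' dX :=
  wbar d + val (Rf z (insubd 0 (d - wbarS (wbar d)))).

Definition Gammafun (z : unit_disc R) (d : dX) : dT' :=
  (Wfun z (op_inverse (fun x => x - val z *: (Wfun z x).2) d)).1.

Definition corresponding_lifting (h : H) : Kfun :=
  (X h, fun z => Gammafun z (to_range_closure DX h)).

End Lifting.

(* Main.v *)
(** Since [||X|| < 1], the defect operator [D = D_X] is bounded below, hence a
bijection of [H] onto [D_X].  The operator [W = wbar + R0 (1 - wbar^* wbar)] is
an isometry; write [W d = A d (+) B d].  The Taylor coefficients of
[A (1 - z B)^-1 d] are [A B^n d], and [|A v|^2 + |B v|^2 = |v|^2] telescopes to
[sum_(n < N) |A B^n d|^2 = |d|^2 - |B^N d|^2].  As [|D h|^2 = |h|^2 - |X h|^2],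
[Y] is an isometry as soon as [B^n -> 0] strongly.

The contraction [B] has the right inverse [L = D T D^-1], because
[B D T = D].  Every [y - L^n B^n y] lies in [ker B^n], and
[<L^n B^n y, d> = <T^n D^-1 B^n y, D d>] tends to [0] because the adjoints of
the powers of a shift [T] tend to [0] strongly and [D^-1 B^n y] stays bounded.
So the union of the kernels [ker B^n] is dense, and [B^n -> 0] strongly because
[||B|| <= 1]. *)

From HB Require Import structures.
Require Import Defs.
From mathcomp Require Import all_boot all_order all_algebra.
From mathcomp Require Import all_classical all_reals all_analysis.
From mathcomp Require Import complex.
From mathcomp Require Import ring lra.

Set Implicit Arguments.
Unset Strict Implicit.
Unset Printing Implicit Defensive.
Import Order.TTheory GRing.Theory Num.Theory.
Import numFieldNormedType.Exports.
Local Open Scope classical_set_scope.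
Local Open Scope ring_scope.

(** * The real-valued norm and the real part of the inner product *)

Section RealInnerProduct.
Variables (R : realType) (V : innerType R).
Local Open Scope complex_scope.
Implicit Types (x y z : V).

Lemma normrE x : `|x| = (rnorm x)%:C.
Proof. by rewrite /rnorm RRe_real// ger0_real. Qed.

Lemma rnorm_ge0 x : 0 <= rnorm x.
Proof. by rewrite -ler0c -normrE normr_ge0. Qed.

Lemma rnorm0 : rnorm (0 : V) = 0.
Proof. by rewrite /rnorm normr0. Qed.

Lemma rnorm_eq0 x : rnorm x = 0 -> x = 0.
Proof. by move=> x0; apply/normr0_eq0; rewrite normrE x0. Qed.

Lemma rnormN x : rnorm (- x) = rnorm x.
Proof. by rewrite /rnorm normrN. Qed.

Lemma rnormB x y : rnorm (x - y) = rnorm (y - x).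
Proof. by rewrite /rnorm distrC. Qed.

Lemma ler_rnormD x y : rnorm (x + y) <= rnorm x + rnorm y.
Proof. by rewrite -lecR rmorphD/= -!normrE ler_normD. Qed.

Lemma rnormZ (a : R[i]) x : rnorm (a *: x) = complex.Re `|a| * rnorm x.
Proof.
by apply: complexI; rewrite rmorphM/= RRe_real ?ger0_real// -!normrE normrZ.
Qed.

Lemma rnormZ_real (r : R) x : rnorm (r%:C *: x) = `|r| * rnorm x.
Proof. by rewrite rnormZ normc_def/= expr0n addr0 sqrtr_sqr. Qed.

Definition rinner x y : R := complex.Re (inner x y).

Lemma rinnerC x y : rinner x y = rinner y x.
Proof. by rewrite /rinner inner_conj; case: (inner y x). Qed.

Lemma rinnerDl x y z : rinner (x + y) z = rinner x z + rinner y z.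
Proof. by rewrite /rinner innerDl raddfD. Qed.

Lemma rinnerDr x y z : rinner z (x + y) = rinner z x + rinner z y.
Proof. by rewrite rinnerC rinnerDl !(rinnerC z). Qed.

Lemma rinnerZl (r : R) x y : rinner (r%:C *: x) y = r * rinner x y.
Proof. by rewrite /rinner innerZl; case: (inner x y) => a b /=; ring. Qed.

Lemma rinnerZr (r : R) x y : rinner x (r%:C *: y) = r * rinner x y.
Proof. by rewrite rinnerC rinnerZl rinnerC. Qed.

Lemma rinnerNl x y : rinner (- x) y = - rinner x y.
Proof.
by rewrite -scaleN1r -[-1](rmorphN1 (real_complex R)) rinnerZl mulN1r.
Qed.

Lemma rinnerNr x y : rinner x (- y) = - rinner x y.
Proof. by rewrite rinnerC rinnerNl rinnerC. Qed.

Lemma rinnerBl x y z : rinner (x - y) z = rinner x z - rinner y z.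
Proof. by rewrite rinnerDl rinnerNl. Qed.

Lemma rinnerBr x y z : rinner z (x - y) = rinner z x - rinner z y.
Proof. by rewrite rinnerDr rinnerNr. Qed.

Lemma rinner0l x : rinner 0 x = 0.
Proof. by rewrite /rinner inner0l. Qed.

Lemma rinnerii x : rinner x x = rnorm x ^+ 2.
Proof.
apply: complexI; rewrite rmorphXn/= -normrE -inner_norm /rinner RRe_real//.
by rewrite ger0_real// inner_ge0.
Qed.

Lemma rinner_eq0 x : (forall y, rinner x y = 0) -> x = 0.
Proof.
by move=> /(_ x)/eqP; rewrite rinnerii sqrf_eq0 => /eqP; exact: rnorm_eq0.
Qed.

Lemma rnormD_sqr x y :
  rnorm (x + y) ^+ 2 = rnorm x ^+ 2 + 2 * rinner x y + rnorm y ^+ 2.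
Proof.
rewrite -!rinnerii rinnerDl !rinnerDr (rinnerC y x); ring.
Qed.

Lemma rnormB_sqr x y :
  rnorm (x - y) ^+ 2 = rnorm x ^+ 2 - 2 * rinner x y + rnorm y ^+ 2.
Proof. by rewrite rnormD_sqr rnormN rinnerNr; ring. Qed.

Lemma rinner_le x y : rinner x y <= rnorm x * rnorm y.
Proof.
have := ler_rnormD x y; rewrite -ler_sqr ?nnegrE ?addr_ge0 ?rnorm_ge0//.
rewrite rnormD_sqr sqrrD -mulr_natl; lra.
Qed.

Lemma normr_rinner_le x y : `|rinner x y| <= rnorm x * rnorm y.
Proof.
by rewrite ler_norml rinner_le andbT lerNl -rinnerNl -(rnormN x) rinner_le.
Qed.

(** The real part of [<x, i y>] is the imaginary part of [<x, y>], so orthogonality can be tested on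
    real parts. *)
Lemma inner0_rinner x y :
  rinner x y = 0 -> rinner x ('i *: y) = 0 -> inner x y = 0.
Proof.
rewrite /rinner [inner x ('i *: y)]inner_conj innerZl (inner_conj x y).
case: (inner x y) => a b /= -> ab.
by apply/eqP; rewrite eq_complex/= eqxx/=; apply/eqP; lra.
Qed.

End RealInnerProduct.

(** * Limits and closures through the real-valued norm *)

Section RealNormTopology.
Variables (R : realType) (V : innerType R).
Local Open Scope complex_scope.

Lemma gt0_realE (e : R[i]) : 0 < e -> e = (complex.Re e)%:C /\ 0 < complex.Re e.
Proof.
move=> e0; have eE : (complex.Re e)%:C = e by rewrite RRe_real// gtr0_real.
by split=> //; rewrite -ltcR eE.
Qed.

Lemma cvg_rnormP (u : nat -> V) (l : V) :
  u @ \oo --> l <-> (fun n => rnorm (u n - l)) @ \oo --> (0 : R).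
Proof.
split.
- move=> /cvgrPdist_lt ul; apply/cvgr0Pnorm_lt => e e0.
  have := ul e%:C; rewrite ltcR => /(_ e0); apply: filterS => n.
  by rewrite normrE ltcR rnormB ger0_norm// rnorm_ge0.
- move=> /cvgr0Pnorm_lt ul; apply/cvgrPdist_lt => e /gt0_realE[-> e0].
  have := ul _ e0; apply: filterS => n.
  by rewrite normrE ltcR rnormB ger0_norm// rnorm_ge0.
Qed.

Lemma closure_rnormP (A : set V) x :
  closure A x <-> forall e : R, 0 < e -> exists2 y, A y & rnorm (x - y) < e.
Proof.
split=> [Ax e e0|Ax B /nbhs_ballP[e /= /gt0_realE[eE e0] eB]].
- have : nbhs x (ball x e%:C) by apply: nbhsx_ballx; rewrite ltcR.
  by move=> /Ax[y [Ay]]; rewrite -ball_normE/= normrE ltcR; exists y.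
- have [y Ay xy] := Ax _ e0; exists y; split=> //; apply: eB.
  by rewrite -ball_normE/= eE normrE ltcR.
Qed.

End RealNormTopology.

Lemma rnorm_cauchy_cvg (R : realType) (V : hilbertType R) (u : nat -> V) :
  (forall e : R, 0 < e -> exists N, forall n, (N <= n)%N ->
    rnorm (u N - u n) < e) ->
  exists l, (fun n => rnorm (u n - l)) @ \oo --> (0 : R).
Proof.
move=> cu; suff /cvg_ex[l /cvg_rnormP ul] : cvg (u @ \oo) by exists l.
apply/cauchy_cvgP; apply: cauchy_exP => e /gt0_realE[-> e0].
have [N uN] := cu _ e0; exists (u N), N => // n /= Nn.
by rewrite -ball_normE/= normrE ltcR uN.
Qed.

Lemma cvg_rnorm (R : realType) (V : innerType R) (u : nat -> V) l :
  (fun n => rnorm (u n - l)) @ \oo --> (0 : R) ->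
    (fun n => rnorm (u n)) @ \oo --> rnorm l.
Proof.
move=> /cvgr0Pnorm_le ul; apply/cvgrPdist_le => e e0.
have := ul _ e0; apply: filterS => n;
  rewrite ger0_norm ?rnorm_ge0// => /(le_trans _); apply.
have := ler_rnormD (u n - l) l; have := ler_rnormD (l - u n) (u n).
rewrite !subrK (rnormB l) ler_distlC => ? ?.
by apply/andP; split; lra.
Qed.

(** The first-order condition at a minimum. The value [r = a / (b + 1)] turns the product into
    [- (a / (b + 1))^2]; the shift by 1 keeps the denominator positive when [b = 0]. *)
Lemma quadratic_ge0_eq0 (R : realFieldType) (a b : R) :
  (forall r : R, 0 <= r * (b * r - a)) -> 0 <= b -> a = 0.
Proof.
move=> h b0; apply/eqP; apply: contraT => a0.
have := h (a / (b + 1)); have b1 : 0 < b + 1 by lra.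
rewrite (_ : _ * _ = - (a / (b + 1)) ^+ 2); last by field; lra.
by rewrite oppr_ge0 le_eqVlt sqrf_eq0 mulf_eq0 invr_eq0 (negbTE a0) gt_eqF//=
  ltNge sqr_ge0.
Qed.

(** * Nearest points in the image of an operator bounded below *)

Section Closest.
Variables (R : realType) (V : hilbertType R) (U : innerType R).
Variables (A : {linear V -> U}) (c C : R).
Hypotheses (c0 : 0 < c) (cA : forall x, c * rnorm x <= rnorm (A x)).
Hypothesis AC : forall x, rnorm (A x) <= C * rnorm x.
Local Open Scope complex_scope.

Lemma cvg_image_rnorm (s : nat -> V) x u :
  (fun n => rnorm (s n - x)) @ \oo --> (0 : R) ->
  (fun n => rnorm (u - A (s n)) ^+ 2) @ \oo --> rnorm (u - A x) ^+ 2.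
Proof.
move=> sx; rewrite expr2; under eq_fun do rewrite expr2.
suff h : (fun n => rnorm (u - A (s n))) @ \oo --> rnorm (u - A x)
  by exact: cvgM.
apply: cvg_rnorm.
apply: (@squeeze_cvgr _ _ _ _ (fun=> 0) (fun n => C * rnorm (s n - x)));
  last 2 first.
- exact: cvg_cst.
- by rewrite -(mulr0 C); apply: cvgM => //; exact: cvg_cst.
apply: nearW => n; rewrite rnorm_ge0/=.
by rewrite opprB addrC addrA subrK -rnormN opprB -linearB/= AC.
Qed.

(** Projection of [u] onto the closure of [A S]. As [A] is bounded below, a minimising sequence is
    already Cauchy in [V], so completeness is asked of [V] alone and the nearest point has the form
    [A x]. *)
Lemma closest_image (S : set V) (u : U) :
  submod_closed [pred x | x \in S] ->
  exists2 x, closure S x & forall s, S s -> inner (u - A x) (A s) = 0.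
Proof.
move=> [S0 SP].
have {}S0 : S 0 by move: S0; rewrite inE.
have {}SP a x y : S x -> S y -> S (a *: x + y).
  by have := SP a x y; rewrite !inE.
have SD x y : S x -> S y -> S (x + y).
  by move=> Sx Sy; rewrite -[x]scale1r; exact: SP.
have SZ a x : S x -> S (a *: x) by move=> Sx; rewrite -[_ *: _]addr0; exact: SP.
pose q x := rnorm (u - A x) ^+ 2.
pose d := inf (q @` S).
have hq : has_inf (q @` S).
  split; first by exists (q 0), 0.
  by exists 0 => _ [s _ <-]; exact: sqr_ge0.
have dq s : S s -> d <= q s by move=> Ss; apply: ge_inf; [exact: hq.2|exists s].
have [s sP] : {s : nat -> V & forall n, S (s n) /\ q (s n) < d + n.+1%:R^-1}.
  apply: (choice (P := fun n x => S x /\ q x < d + n.+1%:R^-1)) => n.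
  have n0 : 0 < n.+1%:R^-1 :> R by rewrite invr_gt0.
  by have [_ [x Sx <-] qx] := inf_adherent n0 hq; exists x.
(* Parallelogram law; [d] is the infimum of the squared distances. *)
have para x y : S x -> S y ->
  (c * rnorm (x - y)) ^+ 2 <= 2 * (q x - d) + 2 * (q y - d).
  move=> Sx Sy; apply: (@le_trans _ _ (rnorm (A (x - y)) ^+ 2)).
    by rewrite ler_sqr ?nnegrE ?rnorm_ge0// mulr_ge0 ?rnorm_ge0// ltW.
  have := dq _ (SZ 2^-1 _ (SD _ _ Sx Sy)).
  rewrite /q; set e := u - A (2^-1 *: _).
  have ee : (u - A x) + (u - A y) = e + e.
    rewrite /e [in RHS]addrACA [in LHS]addrACA; congr (_ + _).
    rewrite -!opprD -(linearD A x y) -(linearD A (2^-1 *: _)); congr (- A _).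
    by rewrite -scalerDl -[2^-1 + _]mulr2n -[_ *+ 2]mulr_natl mulfV
      ?pnatr_eq0// scale1r.
  have -> : A (x - y) = (u - A y) - (u - A x).
    by rewrite linearB opprB [RHS]addrC addrA subrK.
  have := rnormD_sqr (u - A x) (u - A y); rewrite ee rnormD_sqr rinnerii.
  rewrite (rnormB_sqr (u - A y) (u - A x)) (rinnerC (u - A y)); lra.
have [x sx] : exists x, (fun n => rnorm (s n - x)) @ \oo --> (0 : R).
  apply: rnorm_cauchy_cvg => e e0.
  (* Both excesses [q - d] lie below this bound, so [para] gives less than [(c e)^2]. *)
  have ce0 : 0 < (c * e) ^+ 2 / 4 by rewrite divr_gt0// exprn_gt0// mulr_gt0.
  have [N Nce] : exists N : nat, N.+1%:R^-1 < (c * e) ^+ 2 / 4.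
    have /cvgrPdist_lt/(_ _ ce0)[N _ /(_ N (leqnn N))] := @cvg_harmonic R.
    by rewrite /= sub0r normrN ger0_norm ?invr_ge0//; exists N.
  exists N => n Nn; rewrite -(ltr_pM2l c0) -ltr_sqr ?nnegrE ?mulr_ge0
    ?rnorm_ge0 ?ltW//.
  have [SN qN] := sP N; have [Sn qn] := sP n.
  have := para _ _ SN Sn.
  have : n.+1%:R^-1 <= N.+1%:R^-1 :> R
    by rewrite lef_pV2 ?posrE ?ltr0n// ler_nat ltnS.
  move: qN qn Nce; rewrite -!/(q _) ltr_pdivlMr//.
  move: (q _) (q _) ((c * e) ^+ 2) (_ ^+ 2) N.+1%:R^-1 n.+1%:R^-1 => *; lra.
(* The point [x] is only in the closure of [S], so the minimality of [d] reaches [x + v] by passing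
   to the limit along [s n + v]. *)
have qsx v : (fun n => q (s n + v)) @ \oo --> q (x + v).
  apply: cvg_image_rnorm; rewrite (_ : (fun _ => _) = fun n =>
    rnorm (s n - x))//.
  by apply/funext => n; rewrite opprD addrACA subrr addr0.
have dqx v : S v -> d <= q (x + v).
  move=> Sv; apply: (cvgr_to_ge (qsx v)).
  by apply: nearW => n; apply: dq; apply: SD => //; exact: (sP n).1.
have qx : q x = d.
  apply/eqP; rewrite eq_le -{2}[x]addr0 dqx// andbT.
  have h : (fun n : nat => d + n.+1%:R^-1) @ \oo --> d.
    by rewrite -[X in _ --> X]addr0; apply: cvgD;
      [exact: cvg_cst|exact: cvg_harmonic].
  have := qsx 0; rewrite addr0 => qs; apply: (ler_cvg_to qs h).
  by apply: nearW => n; rewrite addr0 ltW// (sP n).2.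
exists x.
  apply/closure_rnormP => e e0.
  have /cvgr0Pnorm_lt/(_ _ e0)[N _ /(_ N (leqnn N))] := sx.
  rewrite ger0_norm ?rnorm_ge0// rnormB => ?; exists (s N) => //;
    exact: (sP N).1.
have orth v : S v -> rinner (u - A x) (A v) = 0.
  move=> Sv; have := @quadratic_ge0_eq0 _ (2 * rinner (u - A x) (A v)) (rnorm
    (A v) ^+ 2).
  suff h : forall r : R, 0 <= r * (rnorm (A v) ^+ 2 * r - 2 * rinner (u - A x)
    (A v)).
    by move=> /(_ h (sqr_ge0 _)) /eqP; rewrite mulf_eq0 pnatr_eq0/= => /eqP.
  move=> r; have := dqx (r%:C *: v) (SZ _ _ Sv).
  rewrite -qx /q linearD/= linearZ/= opprD addrA [leRHS]rnormB_sqr rinnerZr.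
  rewrite -[rnorm (_ *: _) ^+ 2]rinnerii rinnerZr rinnerZl rinnerii; lra.
move=> v Sv; apply: inner0_rinner; first exact: orth.
by rewrite -linearZ/=; apply: orth; exact: SZ.
Qed.

End Closest.

(** * Iterates of operators and unilateral shifts *)

Section LinearIterates.
Variables (R : realType) (V : innerType R) (T : {linear V -> V}).

Lemma iter_linear n : linear (iter n T).
Proof. by elim: n => [//|n IH] a x y; rewrite !iterS IH linearP. Qed.

Lemma iterZ n a x : iter n T (a *: x) = a *: iter n T x.
Proof. by elim: n => [//|n IH]; rewrite !iterS IH linearZ. Qed.

Lemma iterB n x y : iter n T (x - y) = iter n T x - iter n T y.
Proof. by elim: n => [//|n IH]; rewrite !iterS IH linearB. Qed.

Lemma iter_contraction n x :
  (forall y, rnorm (T y) <= rnorm y) -> rnorm (iter n T x) <= rnorm x.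
Proof.
by move=> T1; elim: n => [//|n IH]; rewrite iterS; apply: le_trans (T1 _) IH.
Qed.

Lemma iter_isometry n : is_isometry T -> is_isometry (iter n T).
Proof. by move=> iT; elim: n => [//|n IH] x; rewrite iterS iT. Qed.

End LinearIterates.

Lemma rinner_suml (R : realType) (V : innerType R) n (e : 'I_n -> V) y :
  rinner (\sum_(i < n) e i) y = \sum_(i < n) rinner (e i) y.
Proof.
by elim/big_ind2: _ => [|_ x _ z <- <-|//]; rewrite ?rinner0l ?rinnerDl.
Qed.

Lemma isometry_rnorm (R : realType) (U V : innerType R) (A : U -> V) x :
  is_isometry A -> rnorm (A x) = rnorm x.
Proof. by rewrite /rnorm => ->. Qed.

(** Polarisation: expand the equal norms at [x + y]. *)
Lemma norm_eq_rinner (R : realType) (V U W : innerType R)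
    (A : {linear V -> U}) (B : {linear V -> W}) x y :
  (forall z, rnorm (A z) = rnorm (B z)) ->
    rinner (A x) (A y) = rinner (B x) (B y).
Proof.
move=> AB; have := congr1 (fun r => r ^+ 2) (AB (x + y)).
rewrite !linearD/= !rnormD_sqr !AB; lra.
Qed.

(** Uniformity in [h] makes this the strong convergence to 0 of the adjoint powers applied to [g],
    without naming an adjoint. Replace [g] by a finite combination of vectors in the spaces [T^k E]:
    the range of [T^n] is orthogonal to it once [n] exceeds every such [k]. *)
Lemma shift_weakly_null (R : realType) (V : innerType R) (T : {linear V -> V})
    (g : V) (e : R) : unilateral_shift T -> 0 < e ->
  exists n, forall h, `|rinner (iter n T h) g| <= e * rnorm h.
Proof.
move=> [iT [E [_ orthE spanE]]] e0.
have approx x d : 0 < d -> exists2 y, lin_span (\bigcup_n (iter n T @` E)) y &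
  rnorm (x - y) < d.
  move=> d0; have : closure (lin_span (\bigcup_n (iter n T @` E))) x
    by rewrite spanE.
  by move=> /closure_rnormP; exact.
have orth n k x h : (k < n)%N -> (E : set V) x ->
  rinner (iter n T h) (iter k T x) = 0.
  move=> kn Ex; apply/eqP; rewrite -normr_eq0 eq_le normr_ge0 andbT.
  apply/ler_addgt0Pl => d d0; rewrite addr0.
  (* The added 1 keeps the divisor in [d / b] positive even when [x] is 0. *)
  pose b := rnorm (iter k T x) + 1.
  have b0 : 0 < b by rewrite ltr_pwDr// rnorm_ge0.
  have [h0 [m [c [f [fE h0E]]]] hh0] := approx h _ (divr_gt0 d0 b0).
  have th0 : rinner (iter n T h0) (iter k T x) = 0.
    have -> : iter n T h0 = \sum_(i < m) iter n T (c i *: f i).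
      pose Tn : {linear V -> V} := HB.pack (iter n T)
        (GRing.isLinear.Build _ _ _ _ (iter n T) (iter_linear T n)).
      by rewrite h0E -[iter n T]/(Tn : V -> V) linear_sum.
    rewrite rinner_suml big1// => i _; have [p _ [y Ey <-]] := fE i.
    rewrite iterZ -iterD /rinner innerZl orthE ?mulr0// => npk.
    by move: kn; rewrite -npk ltnNge leq_addr.
  rewrite -[iter n T h](subrK (iter n T h0)) -iterB rinnerDl th0 addr0.
  apply: (le_trans (normr_rinner_le _ _)); rewrite isometry_rnorm;
    last exact: iter_isometry.
  apply: (@le_trans _ _ (d / b * b)); last by rewrite divfK// gt_eqF.
  by rewrite ler_pM ?rnorm_ge0 ?(ltW hh0)// ler_wpDr.
have [g0 [m [c [f [fE g0E]]]] gg0] := approx g _ e0.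
have [k kP] : {k : 'I_m -> nat & forall i, exists2 y, (E : set V) y &
  f i = iter (k i) T y}.
  apply: (choice (P := fun i k =>
    exists2 y, (E : set V) y & f i = iter k T y)) => i.
  by have [p _ [y Ey fi]] := fE i; exists p, y.
exists (\max_i k i).+1 => h.
have hg0 : rinner (iter (\max_i k i).+1 T h) g0 = 0.
  rewrite g0E rinnerC rinner_suml big1// => i _.
  have [y Ey ->] := kP i.
  rewrite -iterZ rinnerC orth ?ltnS ?leq_bigmax//.
  have [_ EZ] := lin_subspace_submod E.
  by have := EZ (c i) y 0; rewrite !inE addr0; apply => //;
    have := rpred0 (in_lin_subspace E); rewrite /in_lin_subspace inE.
rewrite -[g](subrK g0) rinnerDr hg0 addr0.
apply: (le_trans (normr_rinner_le _ _)); rewrite isometry_rnorm;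
  last exact: iter_isometry.
by rewrite mulrC ler_wpM2r ?rnorm_ge0// ltW.
Qed.

(** * Positive operators, defect operators and operator norms *)

Lemma pos_rinner_sym (R : realType) (V : innerType R)
    (D : {linear V -> V}) x y :
  (forall x, 0 <= inner (D x) x) -> rinner (D x) y = rinner x (D y).
Proof.
(* The form [b] vanishes on the diagonal, hence is antisymmetric; antisymmetry at [x] and [i y] is
   the claimed symmetry of real parts. *)
move=> Dpos; pose b x y := complex.Im (inner (D x) y).
have bxx z : b z z = 0 by apply: ger0_Im; exact: Dpos.
have bs z w : b z w = - b w z.
  have := bxx (z + w); rewrite /b linearD/= innerDl.
  rewrite (inner_conj (z + w)) innerDl rmorphD/= -!inner_conj.
  rewrite (inner_conj (z + w)) innerDl rmorphD/= -!inner_conj.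
  rewrite !raddfD/= -!/(b _ _) !bxx; lra.
have := bs x ('i%C *: y); rewrite /b linearZ/=.
rewrite [inner (D x) ('i%C *: y)]inner_conj !innerZl (inner_conj (D x) y).
rewrite /rinner (inner_conj (D y) x).
by case: (inner (D x) y) => a d; case: (inner (D y) x) => a' d' /=; lra.
Qed.

Lemma defect_sqr (R : realType) (U V : innerType R) (C : {linear U -> V})
    (D : {linear U -> U}) x : is_defect C D ->
  rnorm (D x) ^+ 2 = rnorm x ^+ 2 - rnorm (C x) ^+ 2.
Proof.
move=> [_ Dpos [Cs CCs DD]].
rewrite -rinnerii -pos_rinner_sym// DD rinnerBl rinnerii rinnerC; congr (_ - _).
by rewrite /rinner -CCs -/(rinner _ _) rinnerii.
Qed.

Lemma opnorm_lt1P (R : realType) (U V : innerType R) (A : {linear U -> V}) :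
  (opnorm A < 1)%E ->
  exists r : R, [/\ 0 <= r, r < 1 & forall x, rnorm (A x) <= r * rnorm x].
Proof.
move=> A1.
have A0 : (0 <= opnorm A)%E.
  by apply: ereal_sup_ubound; exists 0; rewrite ?linear0 ?rnorm0//= normr0.
have Afin : (opnorm A) \is a fin_num
  by rewrite ge0_fin_numE// (lt_trans A1)// ltry.
exists (fine (opnorm A)); split; first by rewrite fine_ge0.
  by rewrite -lte_fin fineK.
move=> x; have [x0|x0] := eqVneq (rnorm x) 0.
  by rewrite (rnorm_eq0 x0) linear0 !rnorm0 mulr0.
have {x0} : 0 < rnorm x by rewrite lt_neqAle rnorm_ge0 andbT eq_sym.
move=> x0; rewrite -ler_pdivrMr// -lee_fin fineK//.
apply: ereal_sup_ubound; exists ((rnorm x)^-1%:C%C *: x) => /=.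
  by rewrite normrE rnormZ_real ger0_norm ?invr_ge0 ?(ltW x0)// mulVf// gt_eqF.
by rewrite linearZ/= rnormZ_real ger0_norm ?invr_ge0 ?(ltW x0)// mulrC.
Qed.

(** * Uniqueness of Taylor coefficients *)

Lemma power_series_coef_eq0 (R : realType) (V : innerType R) (c : nat -> V) :
  (forall t : R, 0 < t < 1 ->
    (fun n => rnorm (\sum_(0 <= k < n) (t ^+ k)%:C%C *: c k)) @ \oo -->
      (0 : R)) ->
  forall k, c k = 0.
Proof.
(* The constant coefficient comes first: at small [t] the rest of the series is of order [t], so
   [c 0] is arbitrarily small. *)
have c0_eq0 : forall c : nat -> V, (forall t : R, 0 < t < 1 ->
    (fun n => rnorm (\sum_(0 <= k < n) (t ^+ k)%:C%C *: c k)) @ \oo -->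
      (0 : R)) -> c 0%N = 0.
  move=> {}c Sc.
  have h2 : 0 < (2^-1 : R) < 1 by apply/andP; split; lra.
  (* A term at [t = 1/2] is the difference of two consecutive partial sums, all bounded by some [M];
     this gives the witness [M + M]. *)
  have [M M0 cM] : exists2 M : R, 0 <= M & forall k, rnorm (c k) <= M * 2 ^+ k.
    have Sh := Sc _ h2; have /bounded_fun_has_ubound[M MP] := cvg_seq_bounded
      (cvgP _ Sh).
    have {}MP n : rnorm (\sum_(0 <= k < n) (2^-1 ^+ k)%:C%C *: c k) <= M
      by apply: MP; exists n.
    have M0 : 0 <= M by apply: le_trans (MP 0%N); exact: rnorm_ge0.
    exists (M + M) => [|n]; first by rewrite addr_ge0.
    have := ler_rnormD (\sum_(0 <= k < n.+1) (2^-1 ^+ k)%:C%C *: c k)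
      (- \sum_(0 <= k < n) (2^-1 ^+ k)%:C%C *: c k).
    rewrite rnormN big_nat_recr//= addrAC subrr add0r rnormZ_real.
    have := MP n.+1; have := MP n; rewrite ger0_norm ?exprn_ge0 ?invr_ge0//.
    rewrite big_nat_recr//= exprVn => a b d.
    rewrite -ler_pdivrMr ?exprn_gt0// mulrC; exact: le_trans d (lerD b a).
  apply: rnorm_eq0; apply/eqP; rewrite eq_le rnorm_ge0 andbT.
  (* The summand of index [k] is at most [M 2^(k+1) 4^-k = 2 M 2^-k], and these sum to
     [4 M (1 - 2^-m)]. *)
  have tail t m : 0 < t <= 4^-1 ->
      rnorm (\sum_(0 <= k < m) (t ^+ k)%:C%C *: c k.+1) <=
        4 * M * (1 - 2^-1 ^+ m).
    move=> /andP[t0 t4]; elim: m => [|m IH].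
      by rewrite big_geq// rnorm0 expr0 subrr mulr0.
    rewrite big_nat_recr//=; apply: le_trans (ler_rnormD _ _) _.
    rewrite rnormZ_real ger0_norm ?exprn_ge0 ?(ltW t0)//.
    have tm : t ^+ m <= 4^-1 ^+ m
      by rewrite lerXn2r ?nnegrE ?(ltW t0)// invr_ge0.
    have := ler_pM (exprn_ge0 m (ltW t0)) (rnorm_ge0 (c m.+1)) tm (cM m.+1).
    have -> : 4^-1 ^+ m * (M * 2 ^+ m.+1) = 2 * M * 2^-1 ^+ m.
      rewrite exprS (_ : 2^-1 = 4^-1 * 2 :> R); last by field.
      by rewrite exprMn; ring.
    move=> /(lerD IH); rewrite (exprS _ m) => /le_trans; apply.
    move: (2^-1 ^+ m) => x; lra.
  apply/ler_addgt0Pl => e e0; rewrite addr0.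
  (* The first bound allows [tail], the second makes [t * 4 M <= e / 2]; the other half of [e] is
     left for the partial sum. *)
  pose t : R := Num.min 4^-1 (e / 2 / (4 * M + 1)).
  have M1 : 0 < 4 * M + 1 by lra.
  have t0 : 0 < t by rewrite lt_min invr_gt0 ltr0n/= divr_gt0// divr_gt0.
  have t4 : t <= 4^-1 by rewrite ge_min lexx.
  have tM : t * (4 * M) <= e / 2.
    have : t <= e / 2 / (4 * M + 1) by rewrite ge_min lexx orbT.
    by rewrite ler_pdivlMr// mulrDr mulr1; lra.
  have t1 : 0 < t < 1 by rewrite t0/=; lra.
  have e2 : 0 < e / 2 by rewrite divr_gt0.
  have /cvgr0Pnorm_lt/(_ _ e2)[N _ /(_ N.+1 (leqnSn N))] := Sc t t1.
  rewrite ger0_norm ?rnorm_ge0// big_nat_recl//= expr0 scale1r.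
  under eq_bigr do rewrite exprS rmorphM/= -scalerA.
  rewrite -scaler_sumr; set s := \sum_(_ <= _ < _) _ => h.
  have := ler_rnormD (c 0%N + t%:C%C *: s) (- (t%:C%C *: s)).
  rewrite addrK rnormN rnormZ_real ger0_norm ?(ltW t0)// => h'.
  have t04 : 0 < t <= 4^-1 by rewrite t0.
  have : t * rnorm s <= t * (4 * M).
    rewrite ler_wpM2l ?(ltW t0)//; apply: le_trans (tail _ _ t04) _.
    rewrite mulrBr mulr1 lerBlDr lerDl mulr_ge0 ?exprn_ge0 ?invr_ge0//; lra.
  move: (rnorm (c 0%N)) (rnorm s) (rnorm (_ + _)) h h' tM => *; lra.
(* Once [c 0 = 0], a partial sum is [t] times that of the shifted sequence, so the shifted sequence
   satisfies the same hypothesis. *)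
move=> Sc k; elim: k c Sc => [|k IH] c Sc; have c0 := c0_eq0 _ Sc => //.
apply: (IH (fun k => c k.+1)) => t /andP[t0 t1].
have := Sc t; rewrite t0 t1 => /(_ isT)/cvgr0Pnorm_lt St;
  apply/cvgr0Pnorm_lt => e e0.
have [N _ NS] := St _ (mulr_gt0 t0 e0); exists N => // n /= Nn.
have := NS n.+1 (leqW Nn); rewrite /= !ger0_norm ?rnorm_ge0//.
rewrite big_nat_recl//= c0 scaler0 add0r.
under eq_bigr do rewrite exprS rmorphM/= -scalerA.
by rewrite -scaler_sumr rnormZ_real ger0_norm ?(ltW t0)// ltr_pM2l.
Qed.

(** The coefficients are a choice among all expansions of [f]; uniqueness, tested on real points of
    the disc, makes that choice [a]. *)
Lemma taylor_coefE (R : realType) (V : innerType R) (f : unit_disc R -> V) a :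
  power_series_of f a -> taylor_coef f = a.
Proof.
move=> fa; rewrite /taylor_coef; case: xgetP => [b _ fb|/(_ a)//].
apply/funext => k; apply/eqP; rewrite -subr_eq0; apply/eqP.
apply: (power_series_coef_eq0 (c := fun k => b k - a k)) => t /andP[t0 t1].
have t1' : `|t%:C%C| < 1 :> R[i]
  by rewrite normc_def/= expr0n addr0 sqrtr_sqr ger0_norm ?(ltW t0)// ltcR.
pose z : unit_disc R := exist (fun z : R[i] => is_true (`|z| < 1)) t%:C%C t1'.
pose u n : V :=
  series (fun n => val z ^+ n *: b n) n - series (fun n => val z ^+ n *: a n) n.
have uz : u @ \oo --> (0 : V) by rewrite -(subrr (f z));
  exact: (cvgB (fb z) (fa z)).
move: uz => /cvg_rnormP; set w := fun n => _; set w' := fun n => _;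
  suff -> : w = w' by [].
apply/funext => n; rewrite /w /w'.
rewrite subr0 /u /series/= -sumrB; congr rnorm.
by apply: eq_bigr => i _; rewrite rmorphXn/= scalerBr.
Qed.

Lemma unit_disc_norm_lt1 (R : realType) (z : unit_disc R) :
  0 <= complex.Re `|val z| < 1.
Proof.
by rewrite -ltcR -ler0c RRe_real ?normr_real// normr_ge0; exact: svalP z.
Qed.

(** * Expansion and Hardy norm of [A (1 - z B)^-1 v] *)

Section TransferFunction.
Variables (R : realType) (U V : innerType R).
Variables (A : {linear V -> U}) (B : {linear V -> V}).
Hypothesis AB : forall v, rnorm (A v) ^+ 2 + rnorm (B v) ^+ 2 = rnorm v ^+ 2.

Lemma state_contractive v : rnorm (B v) <= rnorm v.
Proof. by rewrite -ler_sqr ?nnegrE ?rnorm_ge0// -(AB v) lerDr sqr_ge0. Qed.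

Lemma output_contractive v : rnorm (A v) <= rnorm v.
Proof. by rewrite -ler_sqr ?nnegrE ?rnorm_ge0// -(AB v) lerDl sqr_ge0. Qed.

Lemma transfer_series (v : V) (x : unit_disc R -> V) :
  (forall z, x z - val z *: B (x z) = v) ->
  power_series_of (fun z => A (x z)) (fun n => A (iter n B v)).
Proof.
move=> xP z; apply/cvg_rnormP.
set r := complex.Re `|val z|;
  have /andP[r0 r1] : 0 <= r < 1 := unit_disc_norm_lt1 z.
apply: (@squeeze_cvgr _ _ _ _ (fun=> 0) (fun n => r ^+ n * rnorm (x z)));
  last 2 first.
- exact: cvg_cst.
- rewrite -(mul0r (rnorm (x z))); apply: cvgM; last exact: cvg_cst.
  by apply: cvg_expr; rewrite ger0_norm.
apply: nearW => n; rewrite rnorm_ge0/=.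
have rX m (w : U) : rnorm (val z ^+ m *: w) = r ^+ m * rnorm w.
  by elim: m => [|m IH]; rewrite ?expr0 ?scale1r ?mul1r// !exprS -scalerA
    rnormZ IH mulrA.
(* Substituting [v = x - z B x] makes the series telescope; the remainder is at most [r^n |x|]. *)
suff -> : series (fun n => val z ^+ n *: A (iter n B v)) n =
    A (x z) - val z ^+ n *: A (iter n B (x z)).
  rewrite addrAC subrr add0r rnormN.
  rewrite rX ler_wpM2l ?exprn_ge0//; apply: le_trans (output_contractive _) _.
  by apply: iter_contraction; exact: state_contractive.
elim: n => [|n IH].
  by rewrite /series/= big_geq// expr0 scale1r subrr.
rewrite seriesS/= {}IH -[v](xP z) iterB iterZ linearB linearZ/= scalerBr
  scalerA -exprSr.
by rewrite -iterSr addrC subrKA.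
Qed.

Lemma transfer_sqnorm (f : unit_disc R -> U) (v : V) :
  power_series_of f (fun n => A (iter n B v)) ->
  (fun n => rnorm (iter n B v)) @ \oo --> (0 : R) ->
  hardy_sqnorm f = (rnorm v ^+ 2)%:E.
Proof.
move=> fA Bv; rewrite /hardy_sqnorm (taylor_coefE fA).
have sE n : \sum_(0 <= k < n) rnorm (A (iter k B v)) ^+ 2 =
    rnorm v ^+ 2 - rnorm (iter n B v) ^+ 2.
  elim: n => [|n IH]; first by rewrite big_geq// subrr.
  by rewrite big_nat_recr//= IH -(AB (iter n B v)); ring.
rewrite (_ : (fun n => _) = fun n =>
  (rnorm v ^+ 2 - rnorm (iter n B v) ^+ 2)%:E).
  apply/cvg_lim => //; apply/cvg_EFin; first exact: nearW.
  rewrite -[X in _ --> X]subr0; apply: cvgB; first exact: cvg_cst.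
  by rewrite -(mulr0 0); under eq_fun do rewrite expr2; exact: cvgM.
by apply/funext => n; rewrite sumEFin sE.
Qed.

End TransferFunction.

(** * Subspaces, orthogonal sums and closed ranges *)

Lemma submod_setT (K : pzRingType) (V : lmodType K) :
  submod_closed [pred x | x \in [set: V]].
Proof. by split=> [|a x y _ _]; rewrite !inE. Qed.

Section HilbertConstructions.
Variable R : realType.

Lemma rinner_val (V : innerType R) (M : lin_subspace V) (x y : carrier M) :
  rinner x y = rinner (val x) (val y).
Proof. by []. Qed.

Lemma rnorm_val (V : innerType R) (M : lin_subspace V) (x : carrier M) :
  rnorm x = rnorm (val x).
Proof.
by apply/eqP; rewrite -(@eqrXn2 _ 2) ?rnorm_ge0// -!rinnerii rinner_val.
Qed.

Lemma rinner_hsum (U V : innerType R) (x y : hsum U V) :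
  rinner x y = rinner x.1 y.1 + rinner x.2 y.2.
Proof. by rewrite /rinner -raddfD. Qed.

Lemma rnorm_hsum (U V : innerType R) (x : hsum U V) :
  rnorm x ^+ 2 = rnorm x.1 ^+ 2 + rnorm x.2 ^+ 2.
Proof. by rewrite -!rinnerii rinner_hsum. Qed.

Lemma to_range_closure_linear (U V : innerType R) (D : {linear U -> V}) :
  linear (to_range_closure D).
Proof. by move=> a x y; apply: val_inj; rewrite /= linearP. Qed.

(** An operator bounded below on a complete space has closed range: the residual [e] lies in the
    closure of the range and is orthogonal to the range, hence is 0. *)
Lemma range_closure_surj (H : hilbertType R) (V : innerType R)
    (D : {linear H -> V}) (c C : R) :
  0 < c -> (forall h, c * rnorm h <= rnorm (D h)) ->
  (forall h, rnorm (D h) <= C * rnorm h) ->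
  forall v, exists h, to_range_closure D h = v.
Proof.
move=> c0 cD DC v.
pose D' : {linear H -> carrier (range_closure D)} := HB.pack
  (to_range_closure D)
  (GRing.isLinear.Build _ _ _ _ _ (@to_range_closure_linear _ _ D)).
have D'E h : rnorm (D' h) = rnorm (D h) by rewrite rnorm_val.
have cD' h : c * rnorm h <= rnorm (D' h) by rewrite D'E.
have D'C h : rnorm (D' h) <= C * rnorm h by rewrite D'E.
have [x _] := closest_image c0 cD' D'C v (submod_setT H).
set e := v - D' x => eD; exists x.
apply/esym/eqP; rewrite -subr_eq0 -/e; apply/eqP.
apply: rnorm_eq0; apply/eqP; rewrite eq_le rnorm_ge0 andbT.
apply/ler_addgt0Pl => d d0; rewrite addr0.
have := valP e; rewrite /in_lin_subspace/= inE =>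
  /closure_rnormP/(_ _ d0)[_ [h _ <-] hd].
have : rnorm e ^+ 2 <= rnorm e * d.
  have -> : rnorm e ^+ 2 = rinner e (e - D' h).
    rewrite rinnerBr rinnerii [rinner e (D' h)](_ : _ = 0) ?subr0//.
    by rewrite /rinner eD.
  by apply: le_trans (rinner_le _ _) _;
    rewrite ler_wpM2l ?rnorm_ge0// rnorm_val ltW.
have := rnorm_ge0 e; rewrite le_eqVlt => /predU1P[<- _|e0]; first exact: ltW.
by rewrite expr2 ler_pM2l.
Qed.

End HilbertConstructions.

(** * Resolvent and iterates of the state operator [B] *)

Section State.
Variables (R : realType) (H : hilbertType R) (V : innerType R).
Variables (D : {linear H -> V}) (Ds : V -> H) (T : {linear H -> H}).
Variables (B : {linear V -> V}) (c : R).
Hypotheses (c0 : 0 < c) (cD : forall h, c * rnorm h <= rnorm (D h)).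
Hypothesis D1 : forall h, rnorm (D h) <= rnorm h.
Hypothesis Dsurj : forall v, exists h, D h = v.
Hypothesis DDs : forall h v, rinner (D h) v = rinner h (Ds v).
Hypothesis B1 : forall v, rnorm (B v) <= rnorm v.

Let D1' h : rnorm (D h) <= 1 * rnorm h. Proof. by rewrite mul1r. Qed.

(* The range of [A = (1 - z B) D] is closed, and [e] orthogonal to it satisfies
   [|e|^2 = <e, z B e> <= |z| |e|^2]. *)
Lemma resolvent_surj (z : unit_disc R) (v : V) : exists x, x - val z *: B x = v.
Proof.
have /andP[] := unit_disc_norm_lt1 z; set r := complex.Re _ => r0 r1.
have rE w : rnorm (val z *: B w) <= r * rnorm w by rewrite rnormZ ler_wpM2l.
(* Composing with [D] moves the equation to the complete space [H], as [closest_image] requires; a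
   solution [x] there yields [D x] in [V]. *)
have lA : linear (fun h => D h - val z *: B (D h)).
  move=> a x y; rewrite !(linearP D) (linearP B) scalerDr opprD addrACA
    scalerBr.
  by rewrite !scalerA mulrC.
pose A : {linear H -> V} := HB.pack (fun h => D h - val z *: B (D h))
  (GRing.isLinear.Build _ _ _ _ _ lA).
have AE h : A h = D h - val z *: B (D h) by [].
have rc0 : 0 < (1 - r) * c by rewrite mulr_gt0// subr_gt0.
have cA h : (1 - r) * c * rnorm h <= rnorm (A h).
  rewrite AE -mulrA.
  apply: (@le_trans _ _ ((1 - r) * rnorm (D h)));
    first by rewrite ler_wpM2l// subr_ge0 ltW.
  have := ler_rnormD (D h - val z *: B (D h)) (val z *: B (D h)); rewrite subrK.
  by have := rE (D h); lra.
have AC h : rnorm (A h) <= (1 + r) * rnorm h.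
  rewrite AE; apply: le_trans (ler_rnormD _ _) _;
    rewrite rnormN mulrDl mul1r lerD//.
  by apply: le_trans (rE _) _; rewrite ler_wpM2l.
have [x _] := closest_image rc0 cA AC v (submod_setT H).
set e := v - A x => eA; exists (D x); rewrite -AE; apply/esym/eqP;
  rewrite -subr_eq0 -/e.
apply/eqP/rnorm_eq0/eqP; apply: contraT => e0.
have {}e0 : 0 < rnorm e by rewrite lt_neqAle eq_sym e0 rnorm_ge0.
have [g ge] := Dsurj e; have := congr1 (@complex.Re R) (eA g I).
rewrite -/(rinner _ _) AE ge rinnerBr rinnerii => /eqP;
  rewrite subr_eq0 => /eqP ee.
have := rinner_le e (val z *: B e);
  rewrite -ee expr2 ler_pM2l// => /le_trans/(_ (rE e)).
by rewrite ler_pMl// leNgt r1.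
Qed.

Hypothesis BDT : forall h, B (D (T h)) = D h.

Lemma iter_state_cvg0 v : unilateral_shift T ->
  (fun n => rnorm (iter n B v)) @ \oo --> (0 : R).
Proof.
move=> Tshift.
have BDTn n h : iter n B (D (iter n T h)) = D h.
  by elim: n => [//|n IH]; rewrite iterSr iterS BDT.
(* [S] is the preimage under [D] of the union of the kernels of the powers of [B]. Density of that
   union near [v] amounts to [e = 0] below. *)
pose S := [set h | exists n, iter n B (D h) = 0].
have B0 m n w : iter n B w = 0 -> iter (m + n) B w = 0.
  by move=> w0; rewrite iterD w0; elim: m => [//|m IH];
    rewrite iterS IH linear0.
have Ssub : submod_closed [pred x | x \in S].
  split; rewrite ?inE; first by exists 0%N; rewrite /= linear0.
  move=> a x y; rewrite !inE => -[n xn] [m ym]; exists (n + m)%N.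
  by rewrite linearP iter_linear (B0 _ _ _ ym) addnC (B0 _ _ _ xn) scaler0
    addr0.
have [x Sx] := closest_image c0 cD D1' v Ssub.
set e := v - D x => eS.
have e_eq0 : e = 0.
  apply/rnorm_eq0/eqP; apply: contraT => e0.
  have {}e0 : 0 < rnorm e by rewrite lt_neqAle eq_sym e0 rnorm_ge0.
  (* Since [|h| <= |e| / c], this choice bounds the pairing by [|e|^2 / 2], whereas it equals
     [|e|^2]. *)
  pose d := c * rnorm e / 2.
  have d0 : 0 < d by rewrite divr_gt0// mulr_gt0.
  have [n nP] := shift_weakly_null (Ds e) Tshift d0.
  have [g gE] := Dsurj e; have [h hE] := Dsurj (iter n B e).
  (* [D (g - T^n h) = e - L^n B^n e], where [L = D T D^-1]. *)
  have Sgh : S (g - iter n T h).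
    by exists n; rewrite linearB/= iterB BDTn gE hE subrr.
  have := congr1 (@complex.Re R) (eS _ Sgh);
    rewrite -/(rinner _ _) linearB/= rinnerBr gE rinnerii.
  move=> /eqP; rewrite subr_eq0 rinnerC DDs => /eqP ee.
  have := nP h; rewrite -ee ger0_norm ?sqr_ge0//.
  have : rnorm h <= rnorm e / c.
    rewrite ler_pdivlMr// mulrC (le_trans (cD h))// hE.
    exact: iter_contraction.
  move=> /(ler_wpM2l (ltW d0)) he /le_trans/(_ he).
  have -> : d * (rnorm e / c) = rnorm e ^+ 2 / 2.
    by rewrite /d; field; rewrite gt_eqF.
  have : 0 < rnorm e ^+ 2 by rewrite exprn_gt0.
  lra.
have vE : v = D x by apply/eqP; rewrite -subr_eq0 -/e e_eq0.
(* For [s] in [S] close to [x], [B^n D s] vanishes from some index on, leaving [B^n D (x - s)]. *)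
apply/cvgr0Pnorm_lt => d d0; have /closure_rnormP/(_ _ d0)[s [N sN] xs] := Sx.
exists N => // n /= Nn; rewrite ger0_norm ?rnorm_ge0//; apply: le_lt_trans xs.
have -> : iter n B v = iter n B (D (x - s)).
  by rewrite vE linearB/= iterB -(subnK Nn) (B0 _ _ (D s)) ?subr0.
by apply: le_trans (D1 _); exact: iter_contraction.
Qed.

End State.

(** The difference [u] of two solutions satisfies [u = z B u], so [|u| <= |z| |u|] with
    [|z| < 1]. *)
Lemma resolvent_inj (R : realType) (V : innerType R) (B : {linear V -> V})
    (z : unit_disc R) x y : (forall v, rnorm (B v) <= rnorm v) ->
  x - val z *: B x = y - val z *: B y -> x = y.
Proof.
move=> B1 xy; have /andP[] := unit_disc_norm_lt1 z;
  set r := complex.Re _ => r0 r1.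
have uE : x - y = val z *: B (x - y).
  rewrite linearB scalerBr; move: (_ *: B x) (_ *: B y) xy =>
    p q /(canRL (subrK p)) ->.
  by rewrite addrAC [y - q]addrC addrK addrC.
apply/eqP; rewrite -subr_eq0; apply/eqP/rnorm_eq0/eqP; apply: contraT => u0.
have {}u0 : 0 < rnorm (x - y) by rewrite lt_neqAle eq_sym u0 rnorm_ge0.
have : rnorm (x - y) <= r * rnorm (x - y) by rewrite {1}uE rnormZ ler_wpM2l.
by rewrite ler_pMl// leNgt r1.
Qed.

(** * The lifting given by a constant isometric parameter *)

Theorem proposition4p6 (R : realType) (H' H : hilbertType R)
    (sepH' : separable_space H') (sepH : separable_space H)
    (T' : {linear H' -> H'}) (T : {linear H -> H}) (X : {linear H -> H'})
    (T'contr : contractive T') (T'cnu : completely_nonunitary T')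
    (Tisom : is_isometry T) (Xcontr : contractive X)
    (T'X : forall h, T' (X h) = X (T h))
    (DT' : {linear H' -> H'}) (DX : {linear H -> H})
    (DT'P : is_defect T' DT') (DXP : is_defect X DX)
    (wbar : {linear carrier (range_closure DX) ->
       hsum (carrier (range_closure DT')) (carrier (range_closure DX))})
    (wbarS : {linear hsum (carrier (range_closure DT'))
       (carrier (range_closure DX)) -> carrier (range_closure DX)})
    (wbarP : is_omega_bar T X wbar) (wbarSP : adjoint_of wbar wbarS)
    (Tshift : unilateral_shift T)
    (X_lt1 : (opnorm X < 1)%E)
    (dimle : hilbert_dim_le (carrier (ker_op wbar)) (carrier (ker_op wbarS)))
    (R0 : {linear carrier (ker_op wbar) -> carrier (ker_op wbarS)})
    (R0isom : is_isometry R0) :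
  let Y := corresponding_lifting X (fun _ => R0) in
  contractive_intertwining_lifting T' T X Y /\ K_isometry Y.
Proof.
have [r [r0 r1 Xr]] := opnorm_lt1P X_lt1.
have Dsqr h : rnorm (DX h) ^+ 2 = rnorm h ^+ 2 - rnorm (X h) ^+ 2
  by exact: defect_sqr.
have c0 : 0 < 1 - r by rewrite subr_gt0.
(* [|D_X h|^2 >= (1 - r^2) |h|^2], and [1 - r^2] exceeds [(1 - r)^2] by [2 r (1 - r) >= 0]. *)
have cDX h : (1 - r) * rnorm h <= rnorm (DX h).
  rewrite -ler_sqr ?nnegrE ?rnorm_ge0 ?mulr_ge0 ?rnorm_ge0 ?(ltW c0)// Dsqr.
  have : rnorm (X h) ^+ 2 <= (r * rnorm h) ^+ 2.
    by rewrite ler_sqr ?nnegrE ?rnorm_ge0 ?mulr_ge0 ?rnorm_ge0.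
  have : 0 <= r * (1 - r) * rnorm h ^+ 2
    by rewrite mulr_ge0 ?sqr_ge0// mulr_ge0// ltW.
  rewrite !exprMn; move: (rnorm h ^+ 2) (rnorm (X h) ^+ 2) => x y; lra.
have DX1 h : rnorm (DX h) <= rnorm h.
  by rewrite -ler_sqr ?nnegrE ?rnorm_ge0// Dsqr lerBlDr lerDl sqr_ge0.
pose D : {linear H -> carrier (range_closure DX)} := HB.pack
  (to_range_closure DX)
  (GRing.isLinear.Build _ _ _ _ _ (@to_range_closure_linear _ _ _ DX)).
have DE h : rnorm (D h) = rnorm (DX h) by rewrite rnorm_val.
have cD h : (1 - r) * rnorm h <= rnorm (D h) by rewrite DE.
have D1 h : rnorm (D h) <= rnorm h by rewrite DE.
have Dsurj v : exists h, D h = v.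
  by apply: (range_closure_surj c0 cDX (C := 1)) => h; rewrite mul1r;
    exact: DX1.
have DDs h v : rinner (D h) v = rinner h (DX (val v)).
  by rewrite rinner_val/= pos_rinner_sym//; case: DXP.
pose DT : {linear H -> carrier (range_closure DX)} := D \o T.
have cDT h : (1 - r) * rnorm h <= rnorm (DT h).
  by rewrite -(isometry_rnorm h Tisom); exact: cD.
have DT1 h : rnorm (DT h) <= 1 * rnorm h.
  by rewrite mul1r -(isometry_rnorm h Tisom); exact: D1.
have [_ wbarDT wbar0] := wbarP.
(* [DT] is bounded below, so its range is closed and [D_X] is the orthogonal sum of that range and a
   part on which [wbar] vanishes. *)
have decomp d : exists g f,
    [/\ d = DT g + f, wbar f = 0 & forall s, rinner f (DT s) = 0].
  have [g _] := closest_image c0 cDT DT1 d (submod_setT H).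
  set f := d - DT g => fDT; exists g, f; split.
  - by rewrite /f addrC subrK.
  - apply: wbar0 => y My.
    have yP : in_lin_subspace (range_closure DT) y
      by rewrite /in_lin_subspace inE.
    have [h hy] := range_closure_surj c0 cDT DT1 (SubspaceElt yP).
    have -> : y = DT h by rewrite -[y]/(val (SubspaceElt yP)) -hy.
    exact: fDT.
  - by move=> s; rewrite /rinner fDT.
(* The terms [|X h|^2] of the two defect identities cancel, leaving [|h|^2 - |T' X h|^2], which is
   [|T h|^2 - |X T h|^2]. *)
have wbar_isom h : rnorm (wbar (DT h)) = rnorm (DT h).
  apply/eqP; rewrite -(@eqrXn2 _ 2) ?rnorm_ge0//; apply/eqP.
  rewrite wbarDT rnorm_hsum/= !rnorm_val/= (defect_sqr _ DT'P) !Dsqr T'X.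
  by rewrite (isometry_rnorm h Tisom); ring.
have adj d y : rinner (wbar d) y = rinner d (wbarS y) by rewrite /rinner wbarSP.
(* Thus [I - wbarS wbar] is the projection onto the second summand of [decomp]; the polarised form
   of [wbar_isom] identifies [wbarS wbar] on the first. *)
have wbarSwbar g f : wbar f = 0 -> (forall s, rinner f (DT s) = 0) ->
    DT g + f - wbarS (wbar (DT g + f)) = f.
  move=> f0 fDT; rewrite linearD f0 addr0;
    suff -> : wbarS (wbar (DT g)) = DT g by rewrite addrAC subrr add0r.
  apply/eqP; rewrite -subr_eq0; apply/eqP/rinner_eq0 => y.
  have [g' [f' [-> f'0 f'DT]]] := decomp y.
  rewrite rinnerBl rinnerC -adj linearD/= f'0 addr0.
  have := @norm_eq_rinner _ _ _ _ (wbar \o DT) DT g' g wbar_isom;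
    rewrite /= => ->.
  by rewrite rinnerDr (rinnerC _ f') f'DT addr0 rinnerC subrr.
pose P d := d - wbarS (wbar d).
have Pker d : in_lin_subspace (ker_op wbar) (P d).
  have [g [f [-> f0 fDT]]] := decomp d; rewrite /P wbarSwbar//.
  by rewrite /in_lin_subspace inE.
pose Q d : carrier (ker_op wbar) := insubd 0 (P d).
have QE d : val (Q d) = P d by apply: insubdK; exact: Pker.
have linQ : linear Q.
  move=> a x y; apply: val_inj;
    rewrite -[LHS]/(val (Q _)) QE /P (linearP wbar) (linearP wbarS).
  by rewrite opprD addrACA -scalerBr -[RHS]/(a *: val (Q x) + val (Q y)) !QE.
pose W d : hsum (carrier (range_closure DT')) (carrier (range_closure DX)) :=
  wbar d + val (R0 (Q d)).
have linW : linear W.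
  by move=> a x y; rewrite /W linQ !linearP/= scalerDr addrACA.
(* The values of [R0] lie in the kernel of [wbarS], hence are orthogonal to the range of [wbar]: the
   cross term vanishes. *)
have Wisom d : rnorm (W d) ^+ 2 = rnorm d ^+ 2.
  have [g [f [dE f0 fDT]]] := decomp d.
  have kP : wbarS (val (R0 (Q d))) = 0.
    by have := valP (R0 (Q d)); rewrite /in_lin_subspace inE.
  rewrite rnormD_sqr adj kP rinnerC rinner0l mulr0 addr0.
  rewrite -rnorm_val (isometry_rnorm _ R0isom) rnorm_val QE /P dE wbarSwbar//
    linearD f0 addr0.
  by rewrite wbar_isom rnormD_sqr rinnerC fDT mulr0 addr0.
pose A : {linear carrier (range_closure DX) -> carrier (range_closure DT')} :=
  HB.pack (fun d => (W d).1) (GRing.isLinear.Build _ _ _ _ (fun d => (W d).1)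
    (fun a x y => congr1 fst (linW a x y))).
pose B : {linear carrier (range_closure DX) -> carrier (range_closure DX)} :=
  HB.pack (fun d => (W d).2) (GRing.isLinear.Build _ _ _ _ (fun d => (W d).2)
    (fun a x y => congr1 snd (linW a x y))).
have AB v : rnorm (A v) ^+ 2 + rnorm (B v) ^+ 2 = rnorm v ^+ 2
  by rewrite -(Wisom v) rnorm_hsum.
have WDT h : W (DT h) = (to_range_closure DT' (X h), D h).
  rewrite /W wbarDT; have -> : Q (DT h) = 0; last by rewrite linear0 addr0.
  apply: val_inj; rewrite QE /P -[DT h]addr0 wbarSwbar ?linear0//.
  by move=> s; rewrite rinner0l.
have ADT h : A (DT h) = to_range_closure DT' (X h)
  by exact: (congr1 fst (WDT h)).
have BDT h : B (DT h) = D h by exact: (congr1 snd (WDT h)).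
have B1 := state_contractive AB.
pose res (z : unit_disc R) v := op_inverse (fun x => x - val z *: (W x).2) v.
(* Solvability of the resolvent equation rules out the default value 0 of [op_inverse]. *)
have resP v z : res z v - val z *: B (res z v) = v.
  rewrite /res /op_inverse; case: xgetP => [x _ //|/= nx].
  by have [x /nx] := resolvent_surj c0 cD D1 Dsurj B1 z v.
have resE v z x : x - val z *: B x = v -> res z v = x.
  by move=> xv; apply: (@resolvent_inj _ _ B z) => //; rewrite resP.
move=> Y.
have YE h : Y h = (X h, fun z => A (res z (D h))) by [].
have ser h : power_series_of (Y h).2 (fun n => A (iter n B (D h))).
  by rewrite YE; exact: transfer_series.
have sq h : hardy_sqnorm (Y h).2 = (rnorm (D h) ^+ 2)%:E.
  apply: (transfer_sqnorm AB (ser h)).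
  exact: (iter_state_cvg0 c0 cD D1 Dsurj DDs B1 BDT).
have YK h : in_K (Y h).
  by split; [exists (fun n => A (iter n B (D h))); exact: ser|rewrite sq ltry].
have linY : linear Y.
  move=> a h k; rewrite !YE linearP; congr pair; apply/funext => z.
  rewrite -[RHS]/(a *: A (res z (D h)) + A (res z (D k))) -(linearP A);
    congr (A _).
  apply: resE; rewrite linearP scalerDr opprD addrACA.
  rewrite scalerA mulrC -scalerA -scalerBr !resP linearP//.
have Ynorm h : Knorm (Y h) = rnorm h.
  by rewrite /Knorm sq/= DE Dsqr addrC subrK sqrtr_sqr ger0_norm// rnorm_ge0.
split; last by split.
split=> [//|//|h|//|h]; last by rewrite Ynorm.
rewrite !YE /isometric_lifting/= T'X; congr pair; apply/funext => z.
rewrite -[RHS]/(A (res z (D (T h)))).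
(* Since [B D T = D], [(1 - z B) D T h = D T h - z D h]. Applying [A] then gives the second
   component of the isometric lifting at [Y h]. *)
have -> : res z (D (T h)) = DT h + val z *: res z (D h).
  apply: resE; rewrite (linearD B) (linearZ_LR B) BDT scalerDr opprD addrACA.
  by rewrite -scalerBr resP subrK.
by rewrite (linearD A) (linearZ_LR A) ADT.
Qed.
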